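(* Let $Q$ be a quadratical quasigroup and let $a,b\in Q$ with $a\neq b$. Then every element $x_1\in Q$ with $x_1\neq aba$ is a member of a $4$-cycle based on $aba$.
   Context: A groupoid is a nonempty set with a binary operation, written as juxtaposition. A groupoid $G$ is right solvable if for all $a,b\in G$ there is a unique $x\in G$ with $ax=b$. It has property A if $(xy)x=(zx)(yz)$ for all $x,y,z\in G$. A quadratical quasigroup is a right solvable groupoid with property A (such a groupoid is known to be a quasigroup). In a quadratical quasigroup $x(yx)=(xy)x$ for all $x,y$, and this element is written $xyx$. For $a\neq b$ in $Q$, a $4$-cycle based on $aba$ is a set $\{x_1,x_2,x_3,x_4\}$ (listed in order) of $4$ distinct elements of $Q$ such that $aba=x_1x_2=x_2x_3=x_3x_4=x_4x_1$. *)

(* Defs.v *)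
From mathcomp Require Import all_boot monoid classical_sets.

Set Implicit Arguments.
Unset Strict Implicit.
Unset Printing Implicit Defensive.

Local Open Scope classical_set_scope.
Local Open Scope group_scope.

(* A groupoid is a [magmaType] (a bare binary operation, written [*]) whose
   carrier is nonempty; nonemptiness is part of [quadratical_quasigroup]. *)

Definition right_solvable (G : magmaType) : Prop :=
  forall a b : G, exists! x : G, a * x = b.

Definition property_A (G : magmaType) : Prop :=
  forall x y z : G, (x * y) * x = (z * x) * (y * z).

Definition quadratical_quasigroup (G : magmaType) : Prop :=
  [/\ inhabited G, right_solvable G & property_A G].

(* The element written xyx; [xyxE] shows that the bracketing is immaterial in
   a quadratical quasigroup. *)
Definition xyx (G : magmaType) (x y : G) : G := (x * y) * x.

Lemma xyxE (G : magmaType) (x y : G) :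
  quadratical_quasigroup G -> xyx x y = x * (y * x).
Proof.
case=> _ rsG aG.
have idem : x * x = x.
  have [u [_ uniq_u]] := rsG (x * x) ((x * x) * x).
  have e1 : u = x by apply: uniq_u.
  have e2 : u = x * x by apply: uniq_u; rewrite (aG x x x).
  by rewrite -e2.
by rewrite /xyx (aG x y x) idem.
Qed.

Definition four_cycle (G : magmaType) (a b : G) (S : set G) : Prop :=
  a <> b /\
  exists x1 x2 x3 x4 : G,
    [/\ S = [set x1; x2; x3; x4],
        [/\ x1 <> x2, x1 <> x3 & x1 <> x4],
        [/\ x2 <> x3, x2 <> x4 & x3 <> x4] &
        [/\ xyx a b = x1 * x2, xyx a b = x2 * x3,
            xyx a b = x3 * x4 & xyx a b = x4 * x1]].

(* Main.v *)
Require Import Defs.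
From mathcomp Require Import all_boot monoid classical_sets.

Set Implicit Arguments.
Unset Strict Implicit.
Unset Printing Implicit Defensive.

(** In the model on the complex plane, [x * y] is the centre of the square with
    consecutive vertices [x] and [y], so a 4-cycle lists the vertices of a square
    centred at [p = aba].  The vertices [x2], [x3], [x4] are found by solving
    [x1 * x2 = p], [x2 * x3 = p], [x3 * x4 = p]; the point is that the square
    closes up, [x4 * x1 = p].  This comes from opposite vertices: property A at
    [z = x2] turns [x1 * x2 = x2 * x3 = p] into [(x3 * x1) * x3 = p]
    ([opposite_vertices]), the algebraic form of saying that [p] is the midpoint
    of [x1] and [x3].  This relation is symmetric in [x1] and [x3]
    ([midpoint_sym]), and property A at [z = x4] then gives
    [(x4 * x1) * p = p = p * p], whence [x4 * x1 = p] by right cancellation.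

    If two of the four vertices coincide, idempotence makes one of them equal to
    [p]; but [x_i = p] if and only if [x_(i+1) = p], by cancellation, so no vertex
    is [p] once [x1] is not. *)

Local Open Scope classical_set_scope.
Local Open Scope group_scope.

Lemma right_solvable_mulI (G : magmaType) :
  right_solvable G -> forall a x y : G, a * x = a * y -> x = y.
Proof.
move=> rsG a x y eq_axy; have [u [_ uniq_u]] := rsG a (a * y).
by rewrite -(uniq_u x eq_axy) -(uniq_u y (erefl _)).
Qed.

Section Quadratical.

Variables (Q : magmaType) (hQ : quadratical_quasigroup Q).

Lemma quad_mulI (a x y : Q) : a * x = a * y -> x = y.
Proof. by case: hQ => _ rsQ _; exact: right_solvable_mulI. Qed.

Lemma quad_A (x y z : Q) : (x * y) * x = (z * x) * (y * z).
Proof. by case: hQ => _ _; apply. Qed.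

Lemma quad_idem (x : Q) : x * x = x.
Proof. by symmetry; apply: (@quad_mulI (x * x)); exact: quad_A. Qed.

(** Property A makes [(z * a) * (a * z)] independent of [z]; when [x * a = y * a],
    the left factors for [z = x] and [z = y] agree and can be cancelled, and this
    leaves [a * x = a * y]. *)
Lemma quad_Imul (a x y : Q) : x * a = y * a -> x = y.
Proof.
move=> eq_xya; apply: (@quad_mulI a); apply: (@quad_mulI (x * a)).
by rewrite {2}eq_xya -!quad_A.
Qed.

Lemma midpoint_sym (x y : Q) : (x * y) * x = (y * x) * y.
Proof. by rewrite (quad_A x y y) quad_idem. Qed.

Lemma opposite_vertices (p x y z : Q) :
  x * y = p -> y * z = p -> (x * z) * x = p.
Proof.
by move=> xy yz; rewrite midpoint_sym (quad_A z x y) xy yz quad_idem.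
Qed.

Lemma square_closes (p x1 x2 x3 x4 : Q) :
  x1 * x2 = p -> x2 * x3 = p -> x3 * x4 = p -> x4 * x1 = p.
Proof.
move=> e12 e23 e34; apply: (@quad_Imul p).
by rewrite -{1}e34 -quad_A (opposite_vertices e12 e23) quad_idem.
Qed.

Lemma next_vertex_neq_center (p x y : Q) : x * y = p -> x <> p -> y <> p.
Proof.
move=> xy xNp yp; apply: xNp; apply: (@quad_Imul p).
by rewrite quad_idem -{1}yp.
Qed.

Lemma adjacent_vertices_neq (p x y : Q) : x * y = p -> x <> p -> x <> y.
Proof. by move=> + xNp eq_xy; rewrite -eq_xy quad_idem. Qed.

Lemma opposite_vertices_neq (p x y z : Q) :
  x * y = p -> y * z = p -> x <> p -> x <> z.
Proof.
move=> xy yz xNp eq_xz; have := opposite_vertices xy yz.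
by rewrite -eq_xz !quad_idem.
Qed.

End Quadratical.

Theorem proposition3p2 (Q : magmaType) (hQ : quadratical_quasigroup Q)
  (a b : Q) (hab : a <> b) (x1 : Q) (hx1 : x1 <> xyx a b) :
  exists S : set Q, four_cycle a b S /\ S x1.
Proof.
case: (hQ) => _ rsQ _; set p := xyx a b in hx1 *.
have [x2 [e12 _]] := rsQ x1 p.
have [x3 [e23 _]] := rsQ x2 p.
have [x4 [e34 _]] := rsQ x3 p.
have e41 := square_closes hQ e12 e23 e34.
have x2Np := next_vertex_neq_center hQ e12 hx1.
have x3Np := next_vertex_neq_center hQ e23 x2Np.
have x4Np := next_vertex_neq_center hQ e34 x3Np.
exists [set x1; x2; x3; x4]; split; last by left; left; left.
split=> //; exists x1, x2, x3, x4; split=> //; split.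
- exact: (adjacent_vertices_neq hQ e12).
- exact: (opposite_vertices_neq hQ e12 e23).
- by move/esym; exact: (adjacent_vertices_neq hQ e41).
- exact: (adjacent_vertices_neq hQ e23).
- exact: (opposite_vertices_neq hQ e23 e34).
- exact: (adjacent_vertices_neq hQ e34).
Qed.
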